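(* Let $y=\sqrt{1-4t}$, regarded as the formal power series in $t$ with constant term $1$. Then, as formal power series in $t$ with coefficients polynomial in $x_1,x_2$, the generating function of two-rooted plane trees $G_2(t,x_1,x_2)=\sum_{d_1,d_2\ge 0}\sum_{e\ge0}T_2(e;d_1,d_2)\,x_1^{d_1}x_2^{d_2}t^e$ is $$G_2(t,x_1,x_2) = \frac{ t \, x_1 \, x_2 \, (y+1)^5 }{ 2 y \, (1+ y -2t x_1)^2 \, (1+ y -2t x_2)^2}.$$
   Context: A plane tree with $e\ge1$ edges is a triple $\Gamma=(H,\alpha,\sigma)$, where $H$ is a set of $2e$ half-edges and $\alpha,\sigma$ are permutations of $H$ such that $\alpha$ is a fixed-point-free involution, the group generated by $\alpha,\sigma$ acts transitively on $H$, and $\sigma$ has exactly $e+1$ cycles (fixed points counted as cycles). Cycles of $\alpha$ are the edges, cycles of $\sigma$ are the vertices (with the cyclic order of half-edges around them), and the degree of a vertex is the length of its cycle. A two-rooted tree is a plane tree together with two distinct half-edges (first and second root) belonging to two distinct cycles of $\sigma$; the corresponding vertices are labeled $v_1,v_2$. An isomorphism of two-rooted trees $(H,\alpha,\sigma)\to(H',\alpha',\sigma')$ is a bijection $\varphi:H\to H'$ with $\alpha=\varphi^{-1}\alpha'\varphi$, $\sigma=\varphi^{-1}\sigma'\varphi$, sending the $k$th root to the $k$th root for $k=1,2$. Isomorphic trees are identified. $T_2(e;d_1,d_2)$ is the number of two-rooted trees with $e$ edges in which $v_1$ has degree $d_1$ and $v_2$ has degree $d_2$; there are none with $e=0$. 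*)

(* Defs.v *)
From HB Require Import structures.
From mathcomp Require Import all_boot all_order all_algebra all_fingroup.
From mathcomp Require Import boolp.
From mathcomp Require Export mpoly.

Set Implicit Arguments.
Unset Strict Implicit.
Unset Printing Implicit Defensive.

Import GRing.Theory.
Local Open Scope ring_scope.

Record fps (R : Type) := Fps { fps_coef :> nat -> R }.

Lemma fpsP (R : Type) (f g : fps R) : f =1 g -> f = g.
Proof. by case: f g => [f] [g] /= /funext ->. Qed.

HB.instance Definition _ (R : Type) := gen_eqMixin (fps R).
HB.instance Definition _ (R : Type) := gen_choiceMixin (fps R).

Section FpsZmodule.
Variable R : zmodType.
Implicit Types f g h : fps R.

Definition fps0 : fps R := Fps (fun=> 0).
Definition fps_opp f : fps R := Fps (fun n => - f n).
Definition fps_add f g : fps R := Fps (fun n => f n + g n).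

Fact fps_addA : associative fps_add.
Proof. by move=> f g h; apply: fpsP => n /=; rewrite addrA. Qed.
Fact fps_addC : commutative fps_add.
Proof. by move=> f g; apply: fpsP => n /=; rewrite addrC. Qed.
Fact fps_add0 : left_id fps0 fps_add.
Proof. by move=> f; apply: fpsP => n /=; rewrite add0r. Qed.
Fact fps_addN : left_inverse fps0 fps_opp fps_add.
Proof. by move=> f; apply: fpsP => n /=; rewrite addNr. Qed.

HB.instance Definition _ :=
  GRing.isZmodule.Build (fps R) fps_addA fps_addC fps_add0 fps_addN.

End FpsZmodule.

Section FpsRing.
Variable R : comNzRingType.
Implicit Types f g h : fps R.

Definition fpsC (c : R) : fps R := Fps (fun n => if n is 0 then c else 0).
Definition fpsX : fps R := Fps (fun n => (n == 1)%:R).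

Definition fps_mul f g : fps R :=
  Fps (fun n => \sum_(i < n.+1) f i * g (n - i)%N).

Definition fps_trunc n f : {poly R} := \poly_(i < n.+1) f i.

Lemma coef_fps_trunc n f i : (i <= n)%N -> (fps_trunc n f)`_i = f i.
Proof. by move=> le_in; rewrite coef_poly ltnS le_in. Qed.

Lemma fps_mulE n f g i :
  (i <= n)%N -> fps_mul f g i = (fps_trunc n f * fps_trunc n g)`_i.
Proof.
move=> le_in; rewrite coefM /=; apply: eq_bigr => j _.
have le_ji : (j <= i)%N by rewrite -ltnS.
by rewrite !coef_fps_trunc ?(leq_trans _ le_in) ?leq_subr.
Qed.

Fact fps_mulC : commutative fps_mul.
Proof. by move=> f g; apply: fpsP => n; rewrite !(fps_mulE _ _ (leqnn n)) mulrC. Qed.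

Fact fps_mulA : associative fps_mul.
Proof.
move=> f g h; apply: fpsP => n; rewrite !(fps_mulE _ _ (leqnn n)).
have trM u v i : (i <= n)%N ->
    (fps_trunc n (fps_mul u v))`_i = (fps_trunc n u * fps_trunc n v)`_i.
  by move=> le_in; rewrite coef_fps_trunc ?(fps_mulE _ _ le_in).
transitivity (fps_trunc n f * (fps_trunc n g * fps_trunc n h))`_n.
  by rewrite !coefM; apply: eq_bigr => j _; rewrite trM ?leq_subr.
by rewrite mulrA !coefM; apply: eq_bigr => j _; rewrite trM // -ltnS.
Qed.

Fact fps_mul1 : left_id (fpsC 1) fps_mul.
Proof.
move=> f; apply: fpsP => n /=.
rewrite big_ord_recl /= mul1r subn0 big1 ?addr0 // => i _.
by rewrite mul0r.
Qed.

Fact fps_mulDl : left_distributive fps_mul (@fps_add R).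
Proof.
move=> f g h; apply: fpsP => n /=.
by rewrite -big_split /=; apply: eq_bigr => i _; rewrite mulrDl.
Qed.

Fact fps_1_neq0 : fpsC 1 != 0 :> fps R.
Proof.
apply/eqP => /(congr1 (fun f : fps R => f 0%N)) /= /eqP.
by rewrite (oner_eq0 R).
Qed.

HB.instance Definition _ := GRing.Zmodule_isComNzRing.Build (fps R)
  fps_mulA fps_mulC fps_mul1 fps_mulDl fps_1_neq0.

Lemma coef_fpsM f g n : (f * g) n = \sum_(i < n.+1) f i * g (n - i)%N.
Proof. by []. Qed.

Lemma coef_fps0M f g : (f * g) 0%N = f 0%N * g 0%N.
Proof. by rewrite coef_fpsM big_ord_recl big_ord0 addr0. Qed.

(* Course-of-values recursion: [step [:: f 0; ...; f (n - 1)]] is [f n]. *)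
Fixpoint fps_rec_seq (step : seq R -> R) n : seq R :=
  if n is m.+1 then
    let s := fps_rec_seq step m in rcons s (step s)
  else [::].

Definition fps_rec step : fps R := Fps (fun n => step (fps_rec_seq step n)).

Lemma fps_recE step n : fps_rec step n = step (mkseq (fps_rec step) n).
Proof.
congr step; elim: n => //= n {1}->.
rewrite [RHS]/mkseq -addn1 iotaD map_cat cats1 add0n -/(mkseq _ _) /=.
by congr rcons; elim: n.
Qed.

End FpsRing.

Section FpsUnitRing.
Variable R : comUnitRingType.
Implicit Types f g h : fps R.

Definition fps_unit : pred (fps R) := fun f => f 0%N \is a GRing.unit.

(* For n > 0 the n-th coefficient of f * g = 1 reads
   f 0 * g n = - \sum_(i < n) g i * f (n - i). *)
Definition fps_inv f : fps R :=
  if fps_unit f then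
    fps_rec (fun s => (f 0%N)^-1 *
      ((size s == 0%N)%:R - \sum_(i < size s) s`_i * f (size s - i)%N))
  else f.

Fact fps_mulVr : {in fps_unit, left_inverse 1 fps_inv *%R}.
Proof.
move=> f Uf; apply: fpsP => n.
rewrite coef_fpsM /fps_inv [fps_unit f]Uf; set g := fps_rec _.
have gE : g n = (f 0%N)^-1 * ((n == 0%N)%:R - \sum_(i < n) g i * f (n - i)%N).
  rewrite [LHS]fps_recE -/g size_mkseq; congr (_ * (_ - _)).
  by apply: eq_bigr => i _; rewrite nth_mkseq.
clearbody g; rewrite big_ord_recr /= subnn [X in _ + X]mulrC gE mulVKr //.
by rewrite addrC subrK; case: n {gE}.
Qed.

Fact fps_unitPl f g : g * f = 1 -> fps_unit f.
Proof.
move/(congr1 (fun h : fps R => h 0%N)); rewrite coef_fps0M /= => gf1.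
by rewrite /fps_unit; apply/unitrPr; exists (g 0%N); rewrite mulrC.
Qed.

Fact fps_inv_out : {in [predC fps_unit], fps_inv =1 id}.
Proof. by move=> f /negbTE /= Uf; rewrite /fps_inv [fps_unit f]Uf. Qed.

HB.instance Definition _ := GRing.ComNzRing_hasMulInverse.Build (fps R)
  fps_mulVr fps_unitPl fps_inv_out.

Lemma fps_unitE f : (f \is a GRing.unit) = (f 0%N \is a GRing.unit).
Proof. by []. Qed.

Lemma fps_sqrt_exists f : (2 : R) \is a GRing.unit -> f 0%N = 1 ->
  exists y : fps R, y 0%N = 1 /\ y ^+ 2 = f.
Proof.
move=> U2 f0.
pose step (s : seq R) := if size s is m.+1 then
  2^-1 * (f m.+1 - \sum_(i < m) s`_i.+1 * s`_(m - i)) else 1.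
pose y := fps_rec step.
have y0 : y 0%N = 1 by [].
have yE n : y n.+1 =
    2^-1 * (f n.+1 - \sum_(i < n) y i.+1 * y (n - i)%N).
  rewrite [LHS]fps_recE -/y /step size_mkseq; congr (_ * (_ - _)).
  apply: eq_bigr => i _.
  by rewrite !nth_mkseq // ltnS ?leq_subr // ltnW.
clearbody y.
exists y; split=> //; apply: fpsP => -[|n].
  by rewrite expr2 coef_fps0M y0 mulr1 f0.
rewrite expr2 coef_fpsM big_ord_recl big_ord_recr /= subnn subn0 y0.
rewrite mul1r mulr1 addrCA -mulr2n -mulr_natl yE mulVKr //.
by under eq_bigr => i _ do rewrite /bump /= add1n subSS; rewrite addrC subrK.
Qed.

Lemma fps_sqrt_uniq (y z : fps R) : (2 : R) \is a GRing.unit ->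
  y 0%N = 1 -> z 0%N = 1 -> y ^+ 2 = z ^+ 2 -> y = z.
Proof.
move=> U2 y0 z0 /eqP; rewrite -subr_eq0 subr_sqr => /eqP yz0.
have Uyz : y + z \is a GRing.unit by rewrite fps_unitE /= y0 z0.
by apply/eqP; rewrite -subr_eq0 -(mulrK Uyz (y - z)) yz0 mul0r.
Qed.

End FpsUnitRing.

Section TwoRootedTrees.
Variable H : finType.

Definition plane_tree (e : nat) (alpha sigma : {perm H}) : bool :=
  [&& (1 <= e)%N, #|H| == (2 * e)%N,
      [forall h, alpha h != h], [forall h, alpha (alpha h) == h],
      [transitive <<[set alpha; sigma]>>%g, on [set: H] | 'P]
    & #|porbits sigma| == e.+1].

(* (alpha, sigma, first root, second root) *)
Definition rooted_data : finType := ({perm H} * {perm H} * H * H)%type.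

Definition two_rooted_tree (e : nat) (X : rooted_data) : bool :=
  let: (alpha, sigma, r1, r2) := X in
  [&& plane_tree e alpha sigma, r1 != r2
    & porbit sigma r1 != porbit sigma r2].

Definition degree1 (X : rooted_data) : nat :=
  let: (alpha, sigma, r1, r2) := X in #|porbit sigma r1|.

Definition degree2 (X : rooted_data) : nat :=
  let: (alpha, sigma, r1, r2) := X in #|porbit sigma r2|.

Definition isomorphic (X X' : rooted_data) : bool :=
  let: (alpha, sigma, r1, r2) := X in
  let: (alpha', sigma', r1', r2') := X' in
  [exists phi : {perm H},
    [&& [forall h, alpha h == (phi^-1)%g (alpha' (phi h))],
        [forall h, sigma h == (phi^-1)%g (sigma' (phi h))],
        phi r1 == r1' & phi r2 == r2']].

Lemma isomorphic_refl : reflexive isomorphic.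
Proof.
move=> [[[a s] r1] r2]; apply/existsP; exists 1%g.
by rewrite !perm1 !eqxx invg1 !andbT; apply/andP; split;
  apply/forallP => h; rewrite !perm1.
Qed.

Lemma isomorphic_sym : ssrbool.symmetric isomorphic.
Proof.
suff sub X Y : isomorphic X Y -> isomorphic Y X.
  by move=> X Y; apply/idP/idP; apply: sub.
case: X Y => [[[a s] r1] r2] [[[a' s'] r1'] r2'].
case/existsP=> p /and4P[/forallP pa /forallP ps /eqP <- /eqP <-].
apply/existsP; exists p^-1%g; rewrite invgK !permK !eqxx !andbT.
apply/andP; split; apply/forallP => h.
  by rewrite (eqP (pa _)) !permKV.
by rewrite (eqP (ps _)) !permKV.
Qed.

Lemma isomorphic_trans : transitive isomorphic.
Proof.
move=> [[[a s] r1] r2] [[[a' s'] r1'] r2'] [[[b u] q1] q2].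
case/existsP=> p /and4P[/forallP pa /forallP ps /eqP <- /eqP <-].
case/existsP=> q /and4P[/forallP qa /forallP qs /eqP <- /eqP <-].
apply/existsP; exists (p * q)%g; rewrite invMg !permM !eqxx !andbT.
apply/andP; split; apply/forallP => h; rewrite !permM.
  by rewrite (eqP (pa _)) (eqP (qa _)).
by rewrite (eqP (ps _)) (eqP (qs _)).
Qed.

End TwoRootedTrees.

(* Every tree with e edges is isomorphic to one whose set of half-edges is
   'I_(2 * e), so these represent all isomorphism classes. *)
Definition T2 (e d1 d2 : nat) : nat :=
  #|equivalence_partition (@isomorphic 'I_(2 * e))
      [set X | [&& two_rooted_tree e X, degree1 X == d1 & degree2 X == d2]]|.

Lemma T2_eq0 e d1 d2 : (2 * e < d1)%N || (2 * e < d2)%N -> T2 e d1 d2 = 0%N.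
Proof.
move=> d_big; rewrite /T2 /equivalence_partition.
set D := [set X | _]; have -> : D = set0; last by rewrite imset0 cards0.
apply/setP=> -[[[a s] r1] r2]; rewrite !inE /=; apply/negP.
case/and3P=> _ /eqP d1E /eqP d2E; move: d_big; rewrite -d1E -d2E.
have le_e x : (#|porbit s x| <= 2 * e)%N.
  by apply: leq_trans (max_card _) _; rewrite card_ord.
by rewrite !ltnNge !le_e.
Qed.

Definition mon2 (d1 d2 : nat) : 'X_{1..2} := [multinom [tuple d1; d2]].

(* The sum is finite because degrees are at most 2 * e; see [coef_G2]. *)
Definition G2 : fps {mpoly rat[2]} :=
  Fps (fun e => \sum_(d1 < (2 * e).+1) \sum_(d2 < (2 * e).+1)
                  (T2 e d1 d2)%:R *: ('X_ord0 ^+ d1 * 'X_ord_max ^+ d2)).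

Lemma coef_G2 e d1 d2 : (G2 e)@_(mon2 d1 d2) = (T2 e d1 d2)%:R.
Proof.
have monE i j : 'X_ord0 ^+ i * 'X_ord_max ^+ j = 'X_[mon2 i j] :> {mpoly rat[2]}.
  rewrite !mpolyXn -mpolyXD; congr mpolyX; apply/mnmP => k.
  rewrite mnmDE !mulmnE !mnm1E multinomE (tnth_nth 0%N) /=.
  by case: k => -[|[|k]] //= lt_k; rewrite ?mul1n ?mul0n ?addn0.
have eq_mon i j : (mon2 i j == mon2 d1 d2) = (i == d1) && (j == d2).
  apply/eqP/andP => [/mnmP E|[/eqP -> /eqP ->]] //.
  by have := E ord0; have := E ord_max; rewrite !multinomE !(tnth_nth 0%N) /= => -> ->.
rewrite /= raddf_sum /=.
under eq_bigr => i _.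
  rewrite raddf_sum /=.
  under eq_bigr => j _ do rewrite monE mcoeffZ mcoeffX eq_mon.
  over.
have [d1_le|d1_gt] := ltnP d1 (2 * e).+1; last first.
  rewrite T2_eq0 ?d1_gt // big1 // => i _; rewrite big1 // => j _.
  by rewrite (ltn_eqF (leq_trans (ltn_ord i) d1_gt)) mulr0.
have [d2_le|d2_gt] := ltnP d2 (2 * e).+1; last first.
  rewrite T2_eq0 ?d2_gt ?orbT // big1 // => i _; rewrite big1 // => j _.
  by rewrite (ltn_eqF (leq_trans (ltn_ord j) d2_gt)) andbF mulr0.
rewrite (bigD1 (Ordinal d1_le)) //= [X in _ + X]big1 ?addr0; last first.
  by move=> i /negbTE ne_i; rewrite big1 // => j _; rewrite -val_eqE /= in ne_i *; rewrite ne_i mulr0.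
rewrite (bigD1 (Ordinal d2_le)) //= [X in _ + X]big1 ?addr0; last first.
  by move=> j /negbTE ne_j; rewrite -val_eqE /= in ne_j; rewrite ne_j andbF mulr0.
by rewrite !eqxx mulr1.
Qed.

Lemma mpoly2_unit : (2 : {mpoly rat[2]}) \is a GRing.unit.
Proof.
apply/unitrPr; exists (2^-1)%:MP.
by rewrite -[2]/(1%:MP *+ 2) -mpolyCMn -mpolyCM mulfV.
Qed.

Lemma sqrt_1B4t_exists :
  exists y : fps {mpoly rat[2]},
    y 0%N = 1 /\ y ^+ 2 = 1 - 4 * fpsX {mpoly rat[2]}.
Proof.
apply: fps_sqrt_exists; first exact: mpoly2_unit.
by rewrite -[LHS]/(1 - (4 * fpsX {mpoly rat[2]}) 0%N) coef_fps0M /= mulr0 subr0.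
Qed.

Lemma denominator_unit (y : fps {mpoly rat[2]}) (p q : {mpoly rat[2]}) :
  y 0%N = 1 ->
  2 * y * (1 + y - 2 * fpsX {mpoly rat[2]} * fpsC p) ^+ 2
        * (1 + y - 2 * fpsX {mpoly rat[2]} * fpsC q) ^+ 2 \is a GRing.unit.
Proof.
move=> y0; set t := fpsX _.
have A c : 1 + y - 2 * t * fpsC c \is a GRing.unit.
  rewrite fps_unitE.
  have E : (2 * t * fpsC c) 0%N = 0 by rewrite !coef_fps0M /= mulr0 mul0r.
  have -> : (1 + y - 2 * t * fpsC c) 0%N = 2.
    by rewrite -[LHS]/((1 + y 0%N) - (2 * t * fpsC c) 0%N) E subr0 y0.
  exact: mpoly2_unit.
rewrite !unitrM !A !andbT; apply/andP; split; rewrite fps_unitE ?y0 ?unitr1 //.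
exact: mpoly2_unit.
Qed.

(* Main.v *)
From HB Require Import structures.
Require Import Defs.
From mathcomp Require Import all_boot all_order all_algebra all_fingroup.
From mathcomp Require Import boolp zify ring.

Set Implicit Arguments.
Unset Strict Implicit.
Unset Printing Implicit Defensive.

Import GRing.Theory.
Local Open Scope ring_scope.

(** Fixing a half-edge of a plane tree leaves no nontrivial automorphism. The walk
    around the tree from the first root, which iterates the face permutation
    [alpha * sigma], visits every half-edge once and numbers them by
    [0, ..., 2 * e - 1]. In this numbering [alpha] becomes a matching of
    parentheses, that is an ordered rooted tree [T] ([mate]), and [sigma] becomes
    [i |-> mate T i + 1] modulo [2 * e] ([turn]). A two-rooted tree is thus the
    same as an ordered tree with a marked half-edge at a vertex other than its
    root ([T2_count]).

    That every plane tree arises in this way is [contour_exists]. It is proved by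
    induction, removing a leaf: [2 * e] half-edges distributed among [e + 1]
    cycles of [sigma] force at least two fixed points, one of which does not lie
    on the edge of the root; putting the leaf back inserts two consecutive steps in the
    contour ([mate_graft]). Conversely the cycles of the rotation of a given tree
    are listed by recursion ([vertices]), which yields both the number of vertices
    and the degrees ([perm_vertices], [fcycle_vertices]).

    It remains to sum [x1 ^ deg root] times [d x2 ^ d] over the ordered trees and
    their vertices of degree [d] other than the root ([G2_tree_gf]). Cutting the
    first edge at the root gives a linear system over the Catalan series
    [C = 1 + t C^2] ([catalan_gf], [root_gf], [closed_root_gf], [others_gf],
    [two_rooted_gf]). As [1 - 2 t C] has constant term 1 and square [1 - 4 t], it
    is [y], and the system is solved in [closed_form]. *)

(** * Ordered trees and their contour matching *)

(** An ordered rooted tree with at least one edge is [Node l r], where [l] is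
    the subtree hanging from the first child of the root and [r] is what is
    left when that child is removed; [Leaf] is the tree with a single vertex.
    As a Dyck word, [Node l r] is an opening step, [l], a closing step, [r]. *)
Inductive tree := Leaf | Node of tree & tree.

HB.instance Definition _ := gen_eqMixin tree.

Section Trees.
Local Open Scope nat_scope.
Implicit Types (T l r : tree) (i j p : nat).

Fixpoint edges T : nat := if T is Node l r then (edges l + edges r).+1 else 0.

(** The fuel [f] bounds the recursion on the two subtrees, whose sizes are not
    structurally smaller than [n]; any [f >= n] gives the same list. *)
Fixpoint trees_fuel (f n : nat) : seq tree :=
  if n is m.+1 then
    if f is f'.+1 then
      flatten [seq [seq Node l r | l <- trees_fuel f' k, r <- trees_fuel f' (m - k)]
              | k <- iota 0 m.+1]
    else [::]
  else [:: Leaf].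

Definition trees n := trees_fuel n n.

Lemma trees_fuelS f m : trees_fuel f.+1 m.+1 =
  flatten [seq [seq Node l r | l <- trees_fuel f k, r <- trees_fuel f (m - k)]
          | k <- iota 0 m.+1].
Proof. by []. Qed.

Lemma trees_fuelE f n : n <= f -> trees_fuel f n = trees n.
Proof.
rewrite /trees; elim/ltn_ind: n f => -[|m] IH [|f] // le_mf.
rewrite !trees_fuelS; congr flatten; apply/eq_in_map => k.
rewrite mem_iota => lt_k.
by rewrite !(IH k) ?(IH (m - k)) //; lia.
Qed.

Lemma treesS m : trees m.+1 =
  flatten [seq [seq Node l r | l <- trees k, r <- trees (m - k)] | k <- iota 0 m.+1].
Proof.
rewrite /trees trees_fuelS; congr flatten; apply/eq_in_map => k.
rewrite mem_iota => lt_k.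
by rewrite !trees_fuelE //; lia.
Qed.

Lemma mem_trees n T : (T \in trees n) = (edges T == n).
Proof.
elim/ltn_ind: n T => -[|m] IH T.
  by rewrite -[trees 0]/[:: Leaf] inE; apply/eqP/eqP; case: T.
rewrite treesS; apply/flatten_mapP/idP => [[k]|].
  rewrite mem_iota => lt_k /allpairsP[[l r] /= []].
  by rewrite !IH; [move=> /eqP Hl /eqP Hr -> /=; apply/eqP; lia | lia | lia].
case: T => // l r /eqP[E].
exists (edges l); first by rewrite mem_iota; lia.
by apply/allpairsP; exists (l, r); split=> //=; rewrite IH //; lia.
Qed.

(** The size of the left subtree is read off the tree, so the blocks of the
    enumeration are disjoint. *)
Lemma uniq_trees n : uniq (trees n).
Proof.
elim/ltn_ind: n => -[|m] IH //; rewrite treesS.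
have -> : [seq [seq Node l r | l <- trees k, r <- trees (m - k)] | k <- iota 0 m.+1]
  = [seq [seq Node lr.1 lr.2 | lr <- [seq (l, r) | l <- trees k, r <- trees (m - k)]]
    | k <- iota 0 m.+1].
  by apply: eq_map => k; rewrite map_allpairs.
apply: allpairs_uniq_dep => [|k|]; first exact: iota_uniq.
  rewrite mem_iota => lt_k.
  apply: allpairs_uniq; [by apply: IH; lia | by apply: IH; lia | by move=> [? ?] [? ?]].
set st := [seq _ | _ <- _, _ <- _].
have tagE : {in st, forall q, tag q = edges (tagged q).1}.
  move=> q /allpairsPdep[k [x [_ /allpairsP[[l r] /= [+ _ ->]] ->]]] /=.
  by rewrite mem_trees => /eqP.
by move=> [k [l r]] [k' [l' r']] /tagE /= -> /tagE /= -> [-> ->].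
Qed.

(** The steps of the contour walk around [T] are numbered from 0; the two
    traversals of an edge are mates of each other. Steps of [l] in [Node l r]
    are shifted by 1, those of [r] by [2 * edges l + 2]. *)
Fixpoint mate T i : nat :=
  match T, i with
  | Leaf, _ => i
  | Node l r, 0 => (2 * edges l).+1
  | Node l r, j.+1 =>
    if j < 2 * edges l then (mate l j).+1
    else if j == 2 * edges l then 0
    else mate r (j - (2 * edges l).+1) + (2 * edges l).+2
  end.

Variant mate_spec l r : nat -> nat -> Type :=
| MateOpen : mate_spec l r 0 (2 * edges l).+1
| MateLeft i of i < 2 * edges l : mate_spec l r i.+1 (mate l i).+1
| MateClose : mate_spec l r (2 * edges l).+1 0
| MateRight i : mate_spec l r (i + (2 * edges l).+2) (mate r i + (2 * edges l).+2).

Lemma mateP l r i : mate_spec l r i (mate (Node l r) i).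
Proof.
case: i => [|i] /=; first exact: MateOpen.
case: ltnP => [lt_i|ge_i]; first exact: MateLeft.
case: eqP => [->|ne_i]; first exact: MateClose.
have Ei : i.+1 = (i - (2 * edges l).+1) + (2 * edges l).+2 by lia.
by rewrite [X in mate_spec _ _ X]Ei; apply: MateRight.
Qed.

Lemma mate_left l r i : i < 2 * edges l -> mate (Node l r) i.+1 = (mate l i).+1.
Proof. by move=> /= ->. Qed.

Lemma mate_close l r : mate (Node l r) (2 * edges l).+1 = 0.
Proof. by rewrite /= ltnn eqxx. Qed.

Lemma mate_right l r i :
  mate (Node l r) (i + (2 * edges l).+2) = mate r i + (2 * edges l).+2.
Proof.
rewrite addnS /= ifF; last by lia.
by rewrite ifF; [congr (mate r _ + _)|]; lia.
Qed.

Lemma mate_lt T i : i < 2 * edges T -> mate T i < 2 * edges T.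
Proof.
elim: T i => [|l IHl r IHr] i //; rewrite ![edges _]/=.
case: mateP => [|j lt_j|| j] lt_i; try lia.
- by have := IHl _ lt_j; lia.
- have := IHr j; lia.
Qed.

Lemma mate_neq T i : i < 2 * edges T -> mate T i != i.
Proof.
elim: T i => [|l IHl r IHr] i //; rewrite ![edges _]/=.
case: mateP => [|j lt_j|| j] lt_i; try lia.
- by have := IHl _ lt_j; lia.
- have := IHr j; lia.
Qed.

Lemma mateK T i : i < 2 * edges T -> mate T (mate T i) = i.
Proof.
elim: T i => [|l IHl r IHr] i //; rewrite ![edges _]/=.
case: (mateP l r i) => [|j lt_j|| j] lt_i.
- by rewrite mate_close.
- by rewrite mate_left ?IHl ?mate_lt.
- by [].
- by rewrite mate_right IHr //; lia.
Qed.

(** The mate of the first step gives the size of the first subtree, hence where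
    to cut the matching. *)
Lemma mate_inj T T' : edges T = edges T' ->
  (forall i, i < 2 * edges T -> mate T i = mate T' i) -> T = T'.
Proof.
elim: T T' => [|l IHl r IHr] [|l' r'] // [eq_e]; rewrite ![edges _]/= => eq_m.
have eq_l : edges l = edges l' by have /= := eq_m 0 isT; lia.
congr Node; [apply: IHl => // i lt_i | apply: IHr => [|i lt_i]].
- have := eq_m i.+1; rewrite !mate_left -?eq_l //.
  by move=> H; apply/succn_inj/H; lia.
- lia.
- have := mate_right l' r' i; rewrite -eq_l -eq_m ?mate_right; last by lia.
  exact: addIn.
Qed.

(** A new leaf drawn in the corner [p] of [T]: the word of [T] receives an
    opening step immediately followed by a closing step at position [p]. *)
Fixpoint graft p T : tree :=
  match T, p with
  | Leaf, _ | _, 0 => Node Leaf T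
  | Node l r, q.+1 =>
    if q <= 2 * edges l then Node (graft q l) r
    else Node l (graft (q - (2 * edges l).+1) r)
  end.

(** Position, after the insertion of two steps at [p], of the old step [i]. *)
Definition skip2 p i := if i < p then i else i.+2.

Lemma edges_graft p T : edges (graft p T) = (edges T).+1.
Proof.
elim: T p => [|l IHl r IHr] [|p] //=.
by case: leqP => _ /=; rewrite ?IHl ?IHr; lia.
Qed.

Lemma mate_graft0 p T : p <= 2 * edges T -> mate (graft p T) p = p.+1.
Proof.
elim: T p => [|l IHl r IHr] [|p] //; rewrite [edges _]/= [graft _ _]/= => le_p.
case: leqP => le_pl.
  by rewrite mate_left ?IHl // edges_graft; lia.
have Ep : p.+1 = (p - (2 * edges l).+1) + (2 * edges l).+2 by lia.
by rewrite [X in mate _ X]Ep mate_right IHr; lia.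
Qed.

Lemma mate_graft p T i : p <= 2 * edges T -> i < 2 * edges T ->
  mate (graft p T) (skip2 p i) = skip2 p (mate T i).
Proof.
elim: T p i => [|l IHl r IHr] [|p] i // le_p.
  by move=> lt_i; rewrite /skip2 !ltn0 -[i.+2]addn2 (mate_right Leaf) muln0 addn2.
rewrite [graft _ _]/=; case: (leqP p (2 * edges l)) => le_pl.
  case: (mateP l r i) => [|j lt_j||j] lt_i.
  - by rewrite /skip2 /= edges_graft ifF; lia.
  - have Es k : skip2 p.+1 k.+1 = (skip2 p k).+1 by rewrite /skip2 ltnS; case: ltnP.
    rewrite !Es mate_left ?IHl // edges_graft /skip2; case: (ltnP j p); lia.
  - rewrite /skip2 ifF ?ltn0Sn; last by lia.
    have -> : (2 * edges l).+3 = (2 * edges (graft p l)).+1 by rewrite edges_graft; lia.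
    by rewrite mate_close.
  - rewrite /skip2 !ifF; try lia.
    have := mate_right (graft p l) r j; rewrite edges_graft.
    have -> : (2 * (edges l).+1).+2 = (2 * edges l).+4 by lia.
    by rewrite !addnS.
case: (mateP l r i) => [|j lt_j||j] lt_i.
- by rewrite /skip2 /= ifT; lia.
- rewrite /skip2 !ifT ?mate_left //; have := mate_lt lt_j; lia.
- by rewrite /skip2 !ifT ?mate_close //; lia.
- have Es k : skip2 p.+1 (k + (2 * edges l).+2) =
     skip2 (p - (2 * edges l).+1) k + (2 * edges l).+2.
    rewrite /skip2; case: (ltnP (_ + _)); case: (ltnP k); lia.
  by rewrite !Es mate_right IHr //; simpl in *; lia.
Qed.

End Trees.

(** * The vertices of a tree as lists of contour steps *)

Section Corners.
Local Open Scope nat_scope.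
Implicit Types (T l r : tree) (i j p : nat).

(** A vertex is recorded by the steps that leave it, in their cyclic order. *)
Fixpoint root_corners T : seq nat :=
  if T is Node l r then 0 :: [seq i + (2 * edges l).+2 | i <- root_corners r]
  else [::].

(** When a tree hangs from an edge, its root also emits the step that goes back
    along this edge, right after the contour of the tree is complete. *)
Definition root_chain T := rcons (root_corners T) (2 * edges T).

Fixpoint other_vertices T : seq (seq nat) :=
  if T is Node l r then
    [seq i.+1 | i <- root_chain l]
    :: [seq [seq i.+1 | i <- c] | c <- other_vertices l]
    ++ [seq [seq i + (2 * edges l).+2 | i <- c] | c <- other_vertices r]
  else [::].

Definition vertices T := root_corners T :: other_vertices T.

Lemma size_vertices T : size (vertices T) = (edges T).+1.
Proof.
elim: T => //= l [IHl] r [IHr].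
by rewrite size_cat !size_map IHl IHr.
Qed.

Lemma perm_vertices T : perm_eq (flatten (vertices T)) (iota 0 (2 * edges T)).
Proof.
elim: T => // l IHl r IHr; set k := 2 * edges l.
have -> : iota 0 (2 * edges (Node l r)) = 0 :: [seq i.+1 | i <- iota 0 k]
    ++ k.+1 :: [seq i + k.+2 | i <- iota 0 (2 * edges r)].
  have -> : 2 * edges (Node l r) = (k + (2 * edges r).+1).+1 by rewrite /=; lia.
  rewrite [LHS]/= iotaD /= add1n; congr (0 :: _ ++ _ :: _).
    by rewrite -[1]addn0 iotaDl.
  by rewrite -[k.+2]addn0 iotaDl; apply: eq_map => i; rewrite addnC addn0.
apply/seq.permP => a; have := seq.permP IHl (preim (fun i => i.+1) a).
have := seq.permP IHr (preim (addn^~ k.+2) a).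
rewrite /= /root_chain map_rcons flatten_cat -!map_flatten -cats1.
rewrite !(count_cat, count_map, map_cat) /= !(count_cat, count_map) -/k.
by case: (a 0) (a k.+1) => -[]; lia.
Qed.

(** The step after [i] around its vertex, before the contour is closed up
    cyclically. The bound on [i] leaves the end of the root chain without
    successor, so that the relation is preserved when [T] becomes a subtree. *)
Definition step T : rel nat := [rel i j | (i < 2 * edges T) && ((mate T i).+1 == j)].

Lemma step_left l r i j : step l i j -> step (Node l r) i.+1 j.+1.
Proof.
by case/andP=> lt_i /eqP <-; rewrite /step /= lt_i; apply/andP; split; lia.
Qed.

Lemma step_right l r i j :
  step r i j -> step (Node l r) (i + (2 * edges l).+2) (j + (2 * edges l).+2).
Proof.
case/andP=> lt_i /eqP <-; rewrite /step /= -/(mate (Node l r) _) mate_right.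
by apply/andP; split; [rewrite /=; lia | rewrite addSn].
Qed.

Lemma root_chainP T : exists2 s, root_chain T = 0 :: s & path (step T) 0 s.
Proof.
elim: T => [|l _ r [s Es Ps]]; first by exists [::].
exists [seq i + (2 * edges l).+2 | i <- 0 :: s].
  rewrite -Es /root_chain map_rcons /=; congr (0 :: rcons _ _); lia.
rewrite [map _ _]/= add0n /=; apply/andP; split.
  by apply/andP; split; rewrite ?eqxx //; lia.
by rewrite -[_.+2]add0n; apply: homo_path Ps => i j; apply: step_right.
Qed.

Lemma cycle_other_vertices T : all (path.cycle (step T)) (other_vertices T).
Proof.
elim: T => //= l IHl r IHr; rewrite all_cat !all_map; apply/and3P; split.
- have [s Es Ps] := root_chainP l.
  have last_s : last 0 s = 2 * edges l.
    by have := last_rcons 0 (root_corners l) (2 * edges l); rewrite -/(root_chain l) Es.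
  rewrite Es /= rcons_path last_map last_s; apply/andP; split.
    by apply: homo_path Ps => i j; apply: step_left.
  by rewrite /step /= ltnn eqxx; lia.
- apply: sub_all IHl => c; apply: homo_cycle => i j; exact: step_left.
- apply: sub_all IHr => c; apply: homo_cycle => i j; exact: step_right.
Qed.

(** The rotation around the vertices: after the mate of [i] has brought the
    walk back to the origin of [i], the contour continues with the next step at
    that vertex. *)
Definition turn T i := (mate T i).+1 %% (2 * edges T).

Lemma turn_step T i j : step T i j -> j < 2 * edges T -> turn T i = j.
Proof. by case/andP=> _ /eqP <- lt_j; rewrite /turn modn_small. Qed.

Lemma vertices_lt T c i : c \in vertices T -> i \in c -> i < 2 * edges T.
Proof.
move=> cT ic; suff: i \in flatten (vertices T).
  by rewrite (perm_mem (perm_vertices T)) mem_iota.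
by apply/flattenP; exists c.
Qed.

(** Only the root needs the reduction modulo the length: its last step is
    followed by the end of the contour, which is step 0. *)
Lemma fcycle_vertices T c : c \in vertices T -> fcycle (turn T) c.
Proof.
move=> cT; have lt_c := vertices_lt cT; move: cT lt_c.
rewrite inE => /predU1P[-> | c_other] lt_c; last first.
  have /allP/(_ c c_other) := cycle_other_vertices T.
  apply: (sub_in_cycle (P := fun i => i < 2 * edges T)); last exact/allP.
  by move=> i j _ lt_j /turn_step/(_ lt_j)/eqP.
have [s] := root_chainP T; rewrite /root_chain; case: (root_corners T) lt_c => //=.
move=> x c0 lt_c [Ex <-]; subst x; rewrite !rcons_path.
case/andP=> Pc /andP[lt_l /eqP last_c]; apply/andP; split; last first.
  by rewrite /= /turn last_c modnn.
move: Pc; apply: (sub_in_path (P := fun i => i < 2 * edges T)).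
  by move=> i j _ lt_j /turn_step/(_ lt_j)/eqP.
by apply/allP => i; apply: lt_c.
Qed.

Lemma other_vertices_neq0 T : [::] \notin other_vertices T.
Proof.
elim: T => //= l IHl r IHr; rewrite inE negb_or mem_cat negb_or.
rewrite /root_chain [_ == _](_ : _ = false); last by case: (root_corners l).
by apply/and3P; split=> //; apply/mapP => -[[|//] H _]; [case/negP: IHl | case/negP: IHr].
Qed.

End Corners.

(** * Permutations attached to a tree *)

Section CycleDecomposition.
Variables (H : finType) (s : {perm H}).
Implicit Types (c : seq H) (cs : seq (seq H)).

Lemma fconnect_porbit x y : fconnect s x y = (y \in porbit s x).
Proof.
apply/idP/porbitP => [xy|[i ->]]; last by rewrite permX fconnect_iter.
by exists (findex s x y); rewrite permX iter_findex.
Qed.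

Lemma porbit_fcycle c x : fcycle s c -> x \in c -> porbit s x = [set y in c].
Proof.
by move=> cyc xc; apply/setP=> y; rewrite -fconnect_porbit (fconnect_cycle cyc) ?inE.
Qed.

Lemma card_porbit_fcycle c x :
  fcycle s c -> uniq c -> x \in c -> #|porbit s x| = size c.
Proof. by move=> cyc Uc xc; rewrite (porbit_fcycle cyc xc) cardsE; apply/card_uniqP. Qed.

Lemma card_porbits_fcycles cs :
    {in cs, forall c, fcycle s c} -> [::] \notin cs ->
    perm_eq (flatten cs) (enum H) ->
  #|porbits s| = size cs.
Proof.
move=> cyc nil_cs p_cs; pose F c := [set y in c].
have U_cs : uniq (flatten cs) by rewrite (perm_uniq p_cs) enum_uniq.
have <- : size (map F cs) = size cs by rewrite size_map.
have /card_uniqP <- : uniq (map F cs).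
  elim: cs nil_cs U_cs {cyc p_cs} => //= c cs IH.
  rewrite inE negb_or eq_sym => /andP[nil_c nil_cs].
  rewrite cat_uniq => /and3P[_ dis /(IH nil_cs) ->]; rewrite andbT.
  apply/mapP => -[d d_cs /setP eq_cd]; case: c => // x c in nil_c dis eq_cd *.
  move/hasPn: dis => /(_ x); rewrite mem_head => /(_ _)/negP[] //.
  have := eq_cd x; rewrite !inE eqxx /= => /esym x_d.
  by apply/flattenP; exists d.
apply: eq_card => A; apply/imsetP/mapP => [[x _ ->]|[c c_cs ->]].
  have : x \in flatten cs by rewrite (perm_mem p_cs) mem_enum.
  by case/flattenP=> c c_cs xc; exists c; rewrite // (porbit_fcycle (cyc c c_cs) xc).
case: c c_cs => [|x c] c_cs; first by rewrite c_cs in nil_cs.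
by exists x => //; rewrite (porbit_fcycle (cyc _ c_cs)) ?mem_head.
Qed.

End CycleDecomposition.

(** When [T] does not have [e] edges the matching need not act on the ordinals
    below [2 * e], and the identity is a default value. *)
Definition tree_alpha (e : nat) (T : tree) : {perm 'I_(2 * e)} :=
  odflt 1%g [pick a : {perm 'I_(2 * e)} | [forall i, val (a i) == mate T i]].

(** In a product of permutations the left factor acts first, so
    [alpha * sigma] is the face permutation; [sigma] is chosen for it to be the
    rotation [i |-> i + 1]. *)
Definition tree_sigma e T : {perm 'I_(2 * e)} :=
  (tree_alpha e T * perm (@ordS_inj (2 * e)))%g.

Definition ord_corners e (c : seq nat) : seq 'I_(2 * e) := pmap insub c.

Section TreePermutations.
Variables (e : nat) (T : tree).
Hypothesis eT : edges T = e.
Local Notation half_edge := 'I_(2 * e).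

Lemma tree_alphaE i : val (tree_alpha e T i) = mate T i.
Proof.
rewrite /tree_alpha; case: pickP => [a /forallP/(_ i)/eqP //|no_a].
pose f (j : half_edge) : half_edge := insubd j (mate T j).
have fE j : val (f j) = mate T j.
  by rewrite /f val_insubd; have := @mate_lt T j; rewrite eT => ->.
have f_inj : injective f.
  apply: (@can_inj _ _ _ f) => j; apply: val_inj.
  by rewrite !fE mateK // eT.
have /forallP[] := no_a (perm f_inj).
by move=> j; rewrite permE fE.
Qed.

Lemma tree_sigmaE i : val (tree_sigma e T i) = turn T i.
Proof. by rewrite permM permE /= tree_alphaE /turn eT. Qed.

Lemma ord_vertices_val c : c \in vertices T -> map val (ord_corners e c) = c.
Proof.
move=> cT; rewrite (pmap_filter (insubK _)); apply/all_filterP/allP => i ic.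
by rewrite isSome_insub; have := vertices_lt cT ic; rewrite eT.
Qed.

Lemma mem_ord_corners c (i : half_edge) : (i \in ord_corners e c) = (val i \in c).
Proof. by rewrite mem_pmap_sub. Qed.

Lemma fcycle_ord_vertices c :
  c \in vertices T -> fcycle (tree_sigma e T) (ord_corners e c).
Proof.
move=> cT; have := fcycle_vertices cT; rewrite -{1}(ord_vertices_val cT) cycle_map.
by apply: sub_cycle => i j /= /eqP E; apply/eqP/val_inj; rewrite tree_sigmaE.
Qed.

Lemma perm_ord_vertices :
  perm_eq (flatten (map (ord_corners e) (vertices T))) (enum half_edge).
Proof.
apply: (perm_map_inj val_inj); rewrite map_flatten -map_comp val_enum_ord.
rewrite (_ : map _ _ = vertices T); first by have := perm_vertices T; rewrite eT.
by rewrite -[RHS]map_id; apply/eq_in_map => c; apply: ord_vertices_val.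
Qed.

Lemma uniq_ord_vertices c : c \in vertices T -> uniq (ord_corners e c).
Proof.
move=> cT; have := perm_uniq perm_ord_vertices; rewrite enum_uniq.
case/(nthP [::]): cT => k lt_k <-.
rewrite -(cat_take_drop k (vertices T)) (drop_nth [::] lt_k) map_cat flatten_cat /=.
rewrite !cat_uniq nth_cat size_take lt_k ltnn subnn /=.
by case/and3P=> _ _ /and3P[].
Qed.

Lemma card_tree_porbits : (0 < e)%N -> #|porbits (tree_sigma e T)| = e.+1.
Proof.
move=> e_gt0; rewrite (card_porbits_fcycles (cs := map (ord_corners e) (vertices T))).
- by rewrite size_map size_vertices eT.
- by move=> _ /mapP[c cT ->]; apply: fcycle_ord_vertices.
- apply/mapP => -[c cT /esym/(congr1 (map val))].
  rewrite ord_vertices_val //= => c0; move: cT; rewrite c0 inE => /predU1P[].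
    by case: T eT e_gt0 => // <-.
  exact/negP/other_vertices_neq0.
- exact: perm_ord_vertices.
Qed.

Lemma card_tree_porbit c (i : half_edge) :
  c \in vertices T -> val i \in c -> #|porbit (tree_sigma e T) i| = size c.
Proof.
move=> cT ic; rewrite (card_porbit_fcycle (fcycle_ord_vertices cT)) ?uniq_ord_vertices //.
  by rewrite -[in RHS](ord_vertices_val cT) size_map.
by rewrite mem_ord_corners.
Qed.

End TreePermutations.

(** * Every plane tree has a contour: removing a leaf *)

Section Contour.
Local Open Scope nat_scope.
Variables (H : finType) (alpha : {perm H}).
Hypotheses (alpha_neq : forall h, alpha h != h) (alphaK : involutive alpha).
Implicit Types (S A : {set H}) (sigma : {perm H}) (h r x y : H).

(** The tree drawn on the half-edges in [S]; outside [S] the permutation [sigma]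
    is the identity. Keeping the ambient type fixed lets leaves be removed
    without changing it: the [#|H| - 2 * e] other half-edges are fixed points of
    [sigma], which is why [e + 1] vertices amount to [#|H| + 1 - e] cycles. *)
Record subtree e S sigma : Prop := Subtree {
  subtree_card : #|S| = 2 * e;
  subtree_alpha : {homo alpha : x / x \in S};
  subtree_sigma : perm_on S sigma;
  subtree_cycles : #|porbits sigma| + e = #|H|.+1;
  subtree_connected : forall A, A \subset S -> A != set0 ->
    {homo alpha : x / x \in A} -> {homo sigma : x / x \in A} -> A = S }.

(** A cycle that is not a fixed point has at least two elements. *)
Lemma leq_double_porbits sigma :
  2 * #|porbits sigma| <= #|H| + #|[set x | sigma x == x]|.
Proof.
have -> : #|H| + #|[set x | sigma x == x]| = \sum_(x in H) (1 + (sigma x == x)).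
  rewrite big_split /= sum1_card; congr (_ + _).
  by rewrite -sum1dep_card big_mkcond /=; apply: eq_bigr => x _; case: eqP.
rewrite (partition_big_imset (porbit sigma)) /= -/(porbits sigma).
rewrite mulnC -sum_nat_const; apply: leq_sum => _ /imsetP[x _ ->].
rewrite (bigD1 x) /= ?inE ?eqxx //; case: eqP => [_|/eqP neq_x]; first by rewrite leq_addr.
have := porbit_perm sigma 1 x; rewrite expg1 => orb_s.
by rewrite (bigD1 (sigma x)) //= orb_s eqxx.
Qed.

(** [2 * e] half-edges make up [e + 1] cycles. *)
Lemma subtree_two_leaves e S sigma :
  subtree e S sigma -> 1 < #|[set x in S | sigma x == x]|.
Proof.
case=> cardS _ onS cyc _; have := leq_double_porbits sigma.
suff : #|[set x | sigma x == x]| <= #|~: S| + #|[set x in S | sigma x == x]|.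
  by have := cardsC S; lia.
rewrite -cardsUI; apply: leq_trans (leq_addr _ _); apply/subset_leq_card/subsetP => x.
by rewrite !inE => ->; case: (x \in S).
Qed.

(** Two leaves [h1 <> h2] that both meet the edge of [r] would be its two ends,
    and this edge would be a whole connected component. *)
Lemma subtree_leaf_avoiding e S sigma r : subtree e.+2 S sigma ->
  exists h, [/\ h \in S, sigma h = h, h != r & alpha h != r].
Proof.
move=> tS; have /card_gt1P[h1 [h2 [h1L h2L neq12]]] := subtree_two_leaves tS.
move: h1L h2L; rewrite !inE => /andP[h1S /eqP fix1] /andP[h2S /eqP fix2].
have [/andP[? ?]|bad1] := boolP ((h1 != r) && (alpha h1 != r)); first by exists h1.
have [/andP[? ?]|bad2] := boolP ((h2 != r) && (alpha h2 != r)); first by exists h2.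
have Eh2 : h2 = alpha h1.
  move: bad1 bad2; rewrite !negb_and !negbK.
  case/orP=> /eqP E1 /orP[] /eqP E2; rewrite ?E1 //.
  - by rewrite E1 E2 eqxx in neq12.
  - by rewrite -E2 alphaK.
  - by rewrite (perm_inj (etrans E1 (esym E2))) eqxx in neq12.
have : [set h1; h2] = S.
  apply: (subtree_connected tS).
  - by apply/subsetP => x /set2P[] ->.
  - by apply/set0Pn; exists h1; rewrite set21.
  - by move=> x /set2P[] ->; rewrite Eh2 ?alphaK !inE eqxx ?orbT.
  - by move=> x /set2P[] ->; rewrite ?fix1 ?fix2 !inE eqxx ?orbT.
by move/(congr1 (fun A => #|A|)); rewrite (subtree_card tS) cards2 neq12; lia.
Qed.

(** Short-circuits [alpha h] in its cycle: its predecessor is sent to its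
    successor. When [h] is a leaf this removes the edge of [h]. *)
Definition prune sigma h : {perm H} :=
  (tperm (alpha h) (sigma^-1 (alpha h)) * sigma)%g.

Section Prune.
Variables (e : nat) (S : {set H}) (sigma : {perm H}) (h : H).
Hypotheses (tS : subtree e.+2 S sigma) (hS : h \in S) (fix_h : sigma h = h).
Local Notation h' := (alpha h).
Local Notation p := ((sigma^-1)%g h').
Local Notation S' := (S :\ h :\ h').
Local Notation sigma' := (prune sigma h).

(** Otherwise the edge of [h] would be a connected component with two
    half-edges, while [S] has at least four. *)
Lemma prune_next_neq : sigma h' != h'.
Proof.
apply/eqP => fix_h'; have : [set h; h'] = S.
  apply: (subtree_connected tS).
  - by apply/subsetP => x /set2P[] -> //; apply: (subtree_alpha tS).
  - by apply/set0Pn; exists h; rewrite set21.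
  - by move=> x /set2P[] ->; rewrite ?alphaK !inE eqxx ?orbT.
  - by move=> x /set2P[] ->; rewrite ?fix_h ?fix_h' !inE eqxx ?orbT.
move/(congr1 (fun A => #|A|)).
by rewrite (subtree_card tS) cards2 eq_sym alpha_neq; lia.
Qed.

Lemma prune_predK : sigma p = h'. Proof. exact: permKV. Qed.

Lemma prune_pred_neq : p != h'.
Proof. by apply: contra prune_next_neq => /eqP E; rewrite -{1}E prune_predK. Qed.

Lemma pruneE x : sigma' x = if x == p then sigma h' else if x == h' then h' else sigma x.
Proof.
rewrite /prune permM; case: tpermP => [->|->|/eqP/negbTE-> /eqP/negbTE->] //.
  by rewrite prune_predK eqxx eq_sym (negbTE prune_pred_neq).
by rewrite eqxx.
Qed.

Lemma prune_pred_in : p \in S'.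
Proof.
rewrite !inE prune_pred_neq /=; apply/andP; split.
  by apply: contra (alpha_neq h) => /eqP E; rewrite -{1}prune_predK E fix_h.
by rewrite -(perm_closed _ (subtree_sigma tS)) prune_predK (subtree_alpha tS).
Qed.

Lemma prune_next_in : sigma h' \in S'.
Proof.
rewrite !inE prune_next_neq perm_closed ?(subtree_sigma tS) ?(subtree_alpha tS) //.
by rewrite andbT -{2}fix_h (inj_eq perm_inj) alpha_neq.
Qed.

(** Splitting the cycle of [alpha h] creates one more cycle on the whole type,
    as the count with one edge less requires. For connectedness, a stable set
    of the pruned tree is stable in the tree, once completed by [h] and
    [alpha h] when it contains the predecessor of [alpha h]. *)
Lemma subtree_prune : subtree e.+1 S' sigma'.
Proof.
have h'S : h' \in S by apply: (subtree_alpha tS).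
have h'S1 : h' \in S :\ h by rewrite !inE alpha_neq.
split.
- have := cardsD1 h S; have := cardsD1 h' (S :\ h).
  by rewrite hS h'S1 (subtree_card tS); lia.
- move=> x; rewrite !inE => /and3P[xh' xh xS].
  rewrite (subtree_alpha tS) // andbT (inj_eq perm_inj) xh /=.
  by rewrite -[X in _ != X]alphaK (inj_eq perm_inj).
- apply/subsetP => x; rewrite !inE pruneE.
  case: (eqVneq x p) => [->|_]; first by have := prune_pred_in; rewrite !inE.
  case: (eqVneq x h') => [->|_] /=; first by rewrite eqxx.
  case: (eqVneq x h) => [->|_] /=; first by rewrite fix_h eqxx.
  by apply: contraR => xS; rewrite (out_perm (subtree_sigma tS)).
- have := porbits_mul_tperm sigma h' p; rewrite /= -/(prune _ _).
  have -> : h' \in porbit sigma p.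
    by have := mem_porbit sigma 1 p; rewrite expg1 prune_predK.
  by rewrite eq_sym prune_pred_neq /= addn0 addn1 => ->; rewrite addSnnS (subtree_cycles tS).
move=> A sAS' A_neq0 aA sA.
have A_neq x : x \in A -> [/\ x != h', x != h & x \in S].
  by move/(subsetP sAS'); rewrite !inE => /and3P.
have [pA|pA] := boolP (p \in A); last first.
  have EA : A = S.
    apply: (subtree_connected tS) => // [|x xA].
      by apply/subsetP=> x /A_neq[].
    have [xh' _ _] := A_neq x xA; have := sA x xA; rewrite pruneE (negbTE xh').
    by case: eqP => // E; rewrite -E xA in pA.
  by have := hS; rewrite -EA => /A_neq[_ /eqP].
have EA : h' |: (h |: A) = S.
  apply: (subtree_connected tS).
  - by rewrite !subUset !sub1set hS h'S /=; apply/subsetP => x /A_neq[].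
  - by apply/set0Pn; exists h'; rewrite !inE eqxx.
  - move=> x; rewrite !inE => /or3P[/eqP->|/eqP->|/aA ->]; rewrite ?alphaK ?eqxx ?orbT //.
  - move=> x; rewrite !inE => /or3P[/eqP->|/eqP->|xA]; rewrite ?fix_h ?eqxx ?orbT //.
      by have := sA p pA; rewrite pruneE eqxx => ->; rewrite !orbT.
    have [xh' _ _] := A_neq x xA; have := sA x xA; rewrite pruneE (negbTE xh').
    by case: eqP => [->|_ ->]; rewrite ?prune_predK ?eqxx ?orbT.
apply/setP => x; rewrite -EA !inE.
have [->|_] := eqVneq x h'; first by apply/negP => /A_neq[/eqP].
by have [->|_] := eqVneq x h; first by apply/negP => /A_neq[_ /eqP].
Qed.

(** The contour of the pruned tree is that of the tree, except for the detour
    through [alpha h] and [h] made just before the successor of [alpha h]. *)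
Lemma face_prune x : x \in S' ->
  (alpha * sigma)%g x =
    if (alpha * sigma')%g x == sigma h' then h' else (alpha * sigma')%g x.
Proof.
move=> xS'; have -> : (alpha * sigma')%g x = sigma' (alpha x) by rewrite permM.
rewrite permM pruneE.
have /negbTE -> : alpha x != h'.
  by rewrite (inj_eq perm_inj); move: xS'; rewrite !inE => /and3P[].
case: (alpha x =P p) => [->|_]; first by rewrite eqxx prune_predK.
rewrite (inj_eq perm_inj) ifF // (inj_eq perm_inj).
by move: xS'; rewrite !inE => /and3P[_ /negbTE].
Qed.

End Prune.

(** Read cyclically from [v], the old cycle is [v :: c]; the function [g] follows
    it up to its last element and then makes the detour [t], [u] before [v]. *)
Lemma fcycle_insert (g g' : H -> H) (t u v : H) (P : {pred H}) (a b c : seq H) :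
    {in P, forall x, g x = if g' x == v then t else g' x} ->
    g t = u -> g u = v -> b ++ a = v :: c -> uniq (v :: c) -> {subset v :: c <= P} ->
  fcycle g' (a ++ b) -> fcycle g (a ++ t :: u :: b).
Proof.
move=> gE gt gu Eba Uvc sP; rewrite !(cycle_catC _ a) Eba !cat_cons Eba /=.
rewrite gt gu !eqxx /= !rcons_path.
case/andP=> path_c /eqP last_c; apply/andP; split; last first.
  by rewrite /= gE ?last_c ?eqxx // sP ?mem_last.
have : {subset v :: c <= P} by [].
move: Uvc path_c; rewrite /= => /andP[vc _].
elim: c {2 3 4}v vc {Eba sP last_c} => //= y c IH x.
rewrite inE negb_or eq_sym => /andP[/negbTE yv vc] /andP[/eqP g'x Pc] sP.
rewrite gE ?sP ?mem_head // g'x yv eqxx IH // => z zc.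
by rewrite sP // inE zc orbT.
Qed.

Lemma nth_insert2 x0 (a b : seq H) t u i :
  nth x0 (a ++ [:: t, u & b]) (skip2 (size a) i) = nth x0 (a ++ b) i.
Proof.
rewrite /skip2 !nth_cat; case: (ltnP i) => [->|le_a] //.
by rewrite ltnNge (leq_trans le_a) ?leqW //= subSn ?subSn // leqW.
Qed.

(** The half-edges listed along the face permutation, starting at [r], are
    matched by [alpha] as the steps of [T] are. *)
Definition contour sigma r (w : seq H) T :=
  [/\ uniq (r :: w), fcycle (alpha * sigma)%g (r :: w) &
    forall i, i < 2 * edges T -> alpha (nth r (r :: w) i) = nth r (r :: w) (mate T i)].

(** Induction on the number of edges. A tree with one edge is immediate; otherwise
    some leaf [h] is such that neither [h] nor [alpha h] is the root [r], and
    the contour of the pruned tree only has to be completed by the two steps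
    along the edge of [h]. *)
Lemma contour_exists e S sigma r : subtree e.+1 S sigma -> r \in S ->
  exists T w, [/\ edges T = e.+1, r :: w =i S & contour sigma r w T].
Proof.
elim: e S sigma => [|e IH] S sigma tS rS.
  have arS : alpha r \in S by apply: (subtree_alpha tS).
  have ES : [set r; alpha r] = S.
    apply/eqP; rewrite eqEcard subUset !sub1set rS arS (subtree_card tS).
    by rewrite cards2 eq_sym alpha_neq.
  have EL : [set x in S | sigma x == x] = S.
    apply/eqP; rewrite eqEcard (subtree_card tS) (subtree_two_leaves tS) andbT.
    by apply/subsetP => x; rewrite inE => /andP[].
  have fixS x : x \in S -> sigma x = x by rewrite -{1}EL inE => /andP[_ /eqP].
  exists (Node Leaf Leaf), [:: alpha r]; split=> //.
    by move=> x; rewrite -ES !inE.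
  split.
  - by rewrite /= inE eq_sym alpha_neq.
  - by rewrite /= !permM alphaK !fixS ?eqxx.
  - by case=> [|[|i]] //= _; rewrite alphaK.
have [h [hS fix_h hr ar]] := subtree_leaf_avoiding r tS.
have tS' := subtree_prune tS hS fix_h.
have rS' : r \in S :\ h :\ alpha h by rewrite !inE rS eq_sym ar eq_sym hr.
have [T [w [eT ES' [Uw cyc mateE]]]] := IH _ _ tS' rS'.
set s := sigma (alpha h); have sS' : s \in S :\ h :\ alpha h by apply: prune_next_in tS _ _.
(* The detour comes just before [s]; if [s] is the root, this is the end of the
   word and not its beginning, so that the word still starts with [r]. *)
have [a [b [c [Eab Eba]]]] : exists a b c, r :: w = (r :: a) ++ b /\ b ++ r :: a = s :: c.
  move: sS'; rewrite -ES'; case: (eqVneq s r) => [-> _|ne_sr].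
    by exists w, [::], w; rewrite cats0.
  rewrite inE (negbTE ne_sr) /= => /splitPr[w1 w2].
  by exists w1, (s :: w2), (w2 ++ r :: w1).
have Pba : perm_eq (s :: c) (r :: w) by rewrite Eab -Eba perm_catC.
have sz : size (r :: w) = 2 * edges T.
  by rewrite eT -(subtree_card tS') -(eq_card ES'); apply/esym/card_uniqP.
set w2 := a ++ [:: alpha h, h & b].
have cons_w2 : r :: w2 = (r :: a) ++ [:: alpha h, h & b] by [].
have P2 : perm_eq (r :: w2) [:: alpha h, h & r :: w].
  by rewrite cons_w2 Eab -![_ :: _ :: b]/([:: _; _] ++ b) perm_catCA.
have szP : size (r :: a) <= 2 * edges T by rewrite -sz Eab size_cat leq_addr.
exists (graft (size (r :: a)) T), w2; split; first by rewrite edges_graft eT.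
  move=> x; rewrite (perm_mem P2) !(inE, ES').
  have [->|_] /= := eqVneq x (alpha h); first by rewrite (subtree_alpha tS).
  by have [->|_] /= := eqVneq x h.
split.
- rewrite (perm_uniq P2) 2!cons_uniq Uw in_cons negb_or alpha_neq !ES' !inE !eqxx.
  by rewrite !andbF.
- rewrite cons_w2; apply: (fcycle_insert (c := c) (P := mem (S :\ h :\ alpha h))
    (g' := (alpha * prune sigma h)%g)); last by rewrite -Eab.
  + by move=> x xS'; apply: (face_prune tS hS fix_h).
  + by rewrite permM alphaK fix_h.
  + by rewrite permM.
  + exact: Eba.
  + by rewrite (perm_uniq Pba).
  + by move=> x; rewrite (perm_mem Pba) ES'.
rewrite edges_graft cons_w2 => i lt_i; set k := size (r :: a) in szP *.
have nth_k : nth r ((r :: a) ++ [:: alpha h, h & b]) k = alpha h.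
  by rewrite nth_cat ltnn subnn.
have nth_k1 : nth r ((r :: a) ++ [:: alpha h, h & b]) k.+1 = h.
  by rewrite nth_cat ltnNge leqnSn /= subSnn.
have [->|ne_k] := eqVneq i k; first by rewrite mate_graft0 // nth_k nth_k1 alphaK.
have [->|ne_k1] := eqVneq i k.+1.
  rewrite -{2}(mate_graft0 szP) mateK ?edges_graft; last by lia.
  by rewrite nth_k nth_k1.
have [j lt_j ->] : exists2 j, j < 2 * edges T & i = skip2 k j.
  case: (ltnP i k) => [lt_ik | le_ki]; first by exists i; rewrite /skip2 ?lt_ik //; lia.
  by exists (i - 2); rewrite /skip2 ?ifF; lia.
by rewrite mate_graft // !nth_insert2 -Eab mateE.
Qed.

End Contour.

(** * Two-rooted trees up to isomorphism are marked ordered trees *)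

Section Representatives.
Variables (X : finType) (I : eqType) (R : rel X) (D : {set X}) (f : I -> X) (L : seq I).

Lemma card_equivalence_partition_reps :
    {in D & &, equivalence_rel R} -> uniq L -> {in L, forall i, f i \in D} ->
    {in L &, forall i j, R (f i) (f j) -> i = j} ->
    {in D, forall x, exists2 i, i \in L & R (f i) x} ->
  #|equivalence_partition R D| = size L.
Proof.
move=> eqR UL fD f_inj f_onto; pose cls i := [set y in D | R (f i) y].
have Rxx x : x \in D -> R x x by move=> xD; case: (eqR x x x).
have <- : size (map cls L) = size L by rewrite size_map.
have /card_uniqP <- : uniq (map cls L).
  rewrite map_inj_in_uniq // => i j iL jL /setP/(_ (f j)).
  by rewrite !inE fD // Rxx ?fD //= => /f_inj->.
apply: eq_card => A; apply/imsetP/mapP => [[x xD ->]|[i iL ->]].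
  have [i iL Rix] := f_onto x xD; exists i => //.
  apply/setP => y; rewrite !inE; case yD: (y \in D) => //=.
  by have [_ ->] := eqR (f i) x y (fD i iL) xD yD.
by exists (f i) => //; apply: fD.
Qed.

End Representatives.

Lemma nth_fcycle (H : eqType) (g : H -> H) x0 x c i :
  fcycle g (x :: c) -> (i < (size c).+1)%N ->
  nth x0 (x :: c) (i.+1 %% (size c).+1) = g (nth x0 (x :: c) i).
Proof.
move=> /(pathP x0) path_c lt_i; have := path_c i; rewrite size_rcons => /(_ lt_i)/eqP.
rewrite -rcons_cons nth_rcons /= lt_i => ->; rewrite nth_rcons.
have [lt_ic|] := ltnP i (size c); first by rewrite modn_small.
move=> ge_ic; have -> : i = size c by apply/eqP; rewrite eqn_leq ge_ic -ltnS lt_i.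
by rewrite modnn eqxx.
Qed.

Section TwoRootedRepresentatives.
Variable e : nat.
Local Notation half_edge := 'I_(2 * e).
Implicit Types (T : tree) (j : half_edge).

Definition origin j : half_edge := insubd j 0%N.

(** The representative of an isomorphism class: half-edges are numbered along
    the contour, from the first root. *)
Definition tree_data (Tj : tree * half_edge) : rooted_data half_edge :=
  (tree_alpha e Tj.1, tree_sigma e Tj.1, origin Tj.2, Tj.2).

Lemma originE j : val (origin j) = 0%N.
Proof. by rewrite val_insubd (leq_ltn_trans _ (ltn_ord j)). Qed.

Lemma half_edge_gt0 (j : half_edge) : (0 < e)%N.
Proof. by case: e j => [[]|]. Qed.

Section OneTree.
Variable T : tree.
Hypothesis eT : edges T = e.

Lemma origin_root j : val (origin j) \in root_corners T.
Proof.
by rewrite originE; have := half_edge_gt0 j; rewrite -eT; case: (T) => //= l r _; rewrite mem_head.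
Qed.

Lemma same_porbit_root j :
  (porbit (tree_sigma e T) (origin j) == porbit (tree_sigma e T) j)
    = (val j \in root_corners T).
Proof.
rewrite eq_porbit_mem porbit_sym.
rewrite (porbit_fcycle (c := ord_corners e (root_corners T))) ?inE ?mem_ord_corners //.
  by apply: fcycle_ord_vertices; rewrite ?mem_head.
exact: origin_root.
Qed.

Lemma tree_alpha_neq i : tree_alpha e T i != i.
Proof.
by rewrite -val_eqE /= [X in X != _](tree_alphaE eT) mate_neq // eT.
Qed.

Lemma tree_alphaK : involutive (tree_alpha e T).
Proof. by move=> i; apply: val_inj; rewrite !(tree_alphaE eT) mateK // eT. Qed.

Lemma tree_faceE i : tree_sigma e T (tree_alpha e T i) = ordS i.
Proof. by rewrite permM permE tree_alphaK. Qed.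

(** The face permutation [i |-> i + 1] alone is already transitive. *)
Lemma plane_tree_rep j : plane_tree e (tree_alpha e T) (tree_sigma e T).
Proof.
have e0 := half_edge_gt0 j; apply/and5P; split.
- by [].
- by rewrite card_ord.
- by apply/forallP => i; apply: tree_alpha_neq.
- by apply/forallP => i; rewrite tree_alphaK.
apply/andP; split; last by rewrite card_tree_porbits.
set G := <<_>>%g.
have aG : tree_alpha e T \in G by rewrite mem_gen // set21.
have sG : tree_sigma e T \in G by rewrite mem_gen // set22.
apply/imsetP; exists (origin j) => //; apply/esym/setP => i; rewrite inE.
suff orb k (lt_k : (k < 2 * e)%N) : Ordinal lt_k \in orbit 'P G (origin j).
  by case: i.
elim: k lt_k => [|k IH] lt_k.
  by rewrite (_ : Ordinal _ = origin j) ?orbit_refl //; apply/val_inj; rewrite originE.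
have lt_k' := ltnW lt_k; have := IH lt_k'; set i0 := Ordinal lt_k' => i0_orb.
rewrite (_ : Ordinal _ = aperm i0 (tree_alpha e T * tree_sigma e T)%g).
  rewrite -[aperm _ _]/('P%act _ _) orbit_actr //; exact: groupM.
by apply/val_inj; rewrite /= apermE permM tree_faceE /= modn_small.
Qed.

Lemma two_rooted_rep j : two_rooted_tree e (tree_data (T, j)) = (val j \notin root_corners T).
Proof.
rewrite /= (plane_tree_rep j) same_porbit_root /=.
case: eqVneq => [<-|_] //=; by rewrite origin_root.
Qed.

Lemma degree1_rep j : degree1 (tree_data (T, j)) = size (root_corners T).
Proof. by rewrite /= (card_tree_porbit eT _ (origin_root j)) ?mem_head. Qed.

End OneTree.

(** An isomorphism commutes with the face permutation [i |-> i + 1] and fixes 0,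
    hence is the identity. *)
Lemma isomorphic_rep_inj T T' j j' : edges T = e -> edges T' = e ->
  isomorphic (tree_data (T, j)) (tree_data (T', j')) -> (T, j) = (T', j').
Proof.
move=> eT eT' /existsP[phi /and4P[/forallP phi_a /forallP phi_s /eqP phi0 /eqP phij]].
have phi_alpha i : phi (tree_alpha e T i) = tree_alpha e T' (phi i).
  by rewrite (eqP (phi_a i)) permKV.
have phi_sigma i : phi (tree_sigma e T i) = tree_sigma e T' (phi i).
  by rewrite (eqP (phi_s i)) permKV.
have phi_face i : phi (ordS i) = ordS (phi i).
  by rewrite -(tree_faceE eT) phi_sigma phi_alpha (tree_faceE eT').
have origin_eq i : val i = 0%N -> phi i = i.
  move=> i0; have -> : i = origin j by apply/val_inj; rewrite i0 originE.
  by rewrite [LHS]phi0; apply/val_inj; rewrite /= !originE.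
have phi_id : phi =1 id.
  case=> k lt_k; elim: k lt_k => [|k IH] lt_k; first exact: origin_eq.
  have lt_k' := ltnW lt_k.
  have -> : Ordinal lt_k = ordS (Ordinal lt_k') by apply/val_inj; rewrite /= modn_small.
  by rewrite phi_face IH.
have -> : j' = j by rewrite -[RHS](phi_id j); apply: esym phij.
congr pair; apply: mate_inj => [|i]; first by rewrite eT eT'.
rewrite eT => lt_i; rewrite -[i]/(val (Ordinal lt_i)) -(tree_alphaE eT) -(tree_alphaE eT').
by rewrite -[in RHS](phi_id (Ordinal lt_i)) -phi_alpha phi_id.
Qed.

Lemma plane_tree_subtree (alpha sigma : {perm half_edge}) :
  plane_tree e alpha sigma -> subtree alpha e [set: half_edge] sigma.
Proof.
case/and5P=> _ /eqP cardH _ _ /andP[trans /eqP cyc]; split.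
- by rewrite cardsT.
- by [].
- exact/subsetP.
- by rewrite cyc cardH; lia.
move=> A _ /set0Pn[x xA] aA sA; apply/eqP; rewrite eqEsubset subsetT /=.
rewrite -(atransP trans x) ?inE // acts_sub_orbit // gen_subG.
apply/subsetP => g /set2P[] ->; rewrite !inE /=; apply/subsetP => y yA;
  rewrite inE /= apermE; [exact: aA | exact: sA].
Qed.

Lemma porbit_conj (s s' phi : {perm half_edge}) x :
  (forall h, phi (s h) = s' (phi h)) -> porbit s' (phi x) = phi @: porbit s x.
Proof.
move=> phi_s; have phi_X i : phi ((s ^+ i)%g x) = (s' ^+ i)%g (phi x).
  by rewrite !permX; elim: i => //= i <-; rewrite phi_s.
apply/setP => y; apply/porbitP/imsetP => [[i ->]|[z /porbitP[i ->] ->]].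
  by exists ((s ^+ i)%g x); rewrite ?mem_porbit.
by exists i.
Qed.

Lemma isomorphic_stats (X Y : rooted_data half_edge) : isomorphic X Y ->
  [/\ degree1 X = degree1 Y, degree2 X = degree2 Y &
    (porbit X.1.1.2 X.1.2 == porbit X.1.1.2 X.2) = (porbit Y.1.1.2 Y.1.2 == porbit Y.1.1.2 Y.2)].
Proof.
case: X Y => [[[a s] r1] r2] [[[a' s'] r1'] r2'].
case/existsP=> phi /and4P[_ /forallP phi_s /eqP <- /eqP <-] /=.
have {}phi_s h : phi (s h) = s' (phi h) by rewrite (eqP (phi_s h)) permKV.
rewrite !(porbit_conj _ phi_s) !(card_imset _ perm_inj).
by rewrite (inj_eq (imset_inj perm_inj)).
Qed.

(** The numbering of the half-edges along a contour is the isomorphism. *)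
Lemma isomorphic_rep_onto X : two_rooted_tree e X ->
  exists Tj, edges Tj.1 = e /\ isomorphic (tree_data Tj) X.
Proof.
case: X => [[[alpha sigma] r1] r2] /and3P[tX _ _].
have [/forallP a_neq /forallP aK] : [forall h, alpha h != h] /\ [forall h, alpha (alpha h) == h].
  by case/and5P: tX.
have a_neq' h : alpha h != h := a_neq h.
have tS := plane_tree_subtree tX.
have Ee : e = e.-1.+1 by rewrite prednK // (half_edge_gt0 r1).
have := contour_exists a_neq' (fun h => eqP (aK h)) (e := e.-1) (sigma := sigma).
rewrite -Ee => /(_ _ r1 tS (in_setT _))[T [w [eT wH [Uw cyc mateE]]]].
have sz_w : (size w).+1 = (2 * e)%N.
  transitivity #|[set: half_edge]|; last by rewrite cardsT card_ord.
  by rewrite -(eq_card wH); apply/esym/card_uniqP.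
pose f (i : half_edge) := nth r1 (r1 :: w) i.
have f_inj : injective f.
  move=> i k /eqP; rewrite /f nth_uniq //= ?sz_w // => /eqP.
  exact: val_inj.
pose phi := perm f_inj.
have phiE i : phi i = nth r1 (r1 :: w) i by rewrite permE.
exists (T, (phi^-1)%g r2); split=> //.
have phi_alpha i : phi (tree_alpha e T i) = alpha (phi i).
  by rewrite !phiE (tree_alphaE eT) -mateE // eT.
have phi_face i : phi (ordS i) = (alpha * sigma)%g (phi i).
  by rewrite !phiE; have := nth_fcycle r1 (i := i) cyc; rewrite sz_w; apply.
apply/existsP; exists phi; apply/and4P; split.
- by apply/forallP => i; rewrite -phi_alpha permK.
- apply/forallP => i; rewrite -[sigma _](_ : phi (tree_sigma e T i) = _) ?permK //.
  by rewrite -{1}[i](tree_alphaK eT) (tree_faceE eT) phi_face permM phi_alpha (eqP (aK _)).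
- by rewrite phiE originE.
- by rewrite permKV.
Qed.

Definition marked_trees : seq (tree * half_edge) :=
  [seq (T, j) | T <- trees e, j <- enum 'I_(2 * e)].

(** The representative of a class may be taken on any ordered tree with [e] edges;
    the only condition left is that the second root leaves another vertex than
    the first one, which is half-edge 0. *)
Lemma T2_count d1 d2 :
  T2 e d1 d2 = count (fun Tj : tree * half_edge =>
      [&& val Tj.2 \notin root_corners Tj.1, size (root_corners Tj.1) == d1
        & #|porbit (tree_sigma e Tj.1) Tj.2| == d2]) marked_trees.
Proof.
rewrite -size_filter; set P := (P in filter P _).
have markedE Tj : (Tj \in marked_trees) = (edges Tj.1 == e).
  case: Tj => T j; apply/allpairsP/idP => [[[T1 j1] /= [+ _ [-> _]]]|eT].
    by rewrite mem_trees.
  by exists (T, j); rewrite mem_trees mem_enum.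
have PE T j : edges T = e -> P (T, j) = [&& two_rooted_tree e (tree_data (T, j)),
   degree1 (tree_data (T, j)) == d1 & degree2 (tree_data (T, j)) == d2].
  by move=> eT; rewrite two_rooted_rep // degree1_rep.
apply: (card_equivalence_partition_reps (f := tree_data)).
- move=> X Y Z _ _ _; split; first exact: isomorphic_refl.
  by move=> XY; apply/idP/idP; apply: isomorphic_trans; rewrite // isomorphic_sym.
- apply/filter_uniq/allpairs_uniq; rewrite ?uniq_trees ?enum_uniq //.
  by move=> [? ?] [? ?].
- move=> [T j]; rewrite mem_filter markedE inE => /andP[+ /eqP eT].
  by rewrite PE.
- move=> [T j] [T' j']; rewrite !mem_filter !markedE => /andP[_ /eqP eT] /andP[_ /eqP eT'].
  exact: isomorphic_rep_inj.
move=> X; rewrite inE => /and3P[tX deg1 deg2].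
have [[T j] [eT iso]] := isomorphic_rep_onto tX.
exists (T, j) => //; rewrite mem_filter markedE eT eqxx andbT PE //.
have [-> -> same] := isomorphic_stats iso; rewrite deg1 deg2 !andbT.
rewrite two_rooted_rep // -same_porbit_root // [_ == _]same.
by case: X tX {deg1 deg2 iso same} => [[[a s] r1] r2] /and3P[_ _].
Qed.

End TwoRootedRepresentatives.

(** * Generating functions *)

Section GeneratingFunctions.
Variable R : comNzRingType.
Implicit Types (g : tree -> R) (f : fps R).

Lemma coef_fpsXM f n : (fpsX R * f) n = if n is m.+1 then f m else 0.
Proof.
case: n => [|n]; first by rewrite coef_fps0M /= mul0r.
rewrite coef_fpsM !big_ord_recl /= mul0r add0r mul1r subSS subn0 big1 ?addr0 // => i _.
by rewrite mul0r.
Qed.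

Lemma coef_fpsCM c f n : (fpsC c * f) n = c * f n.
Proof.
rewrite coef_fpsM big_ord_recl /= subn0 big1 ?addr0 // => i _; exact: mul0r.
Qed.

Definition tree_gf g : fps R := Fps (fun n => \sum_(T <- trees n) g T).

Lemma tree_gfD g g' : tree_gf (fun T => g T + g' T) = tree_gf g + tree_gf g'.
Proof. by apply: fpsP => n; apply: big_split. Qed.

Lemma tree_gfZ c g : tree_gf (fun T => c * g T) = fpsC c * tree_gf g.
Proof. by apply: fpsP => n; rewrite coef_fpsCM /= mulr_sumr. Qed.

(** Sums over the trees [Node l r], without the factor [t] of the root edge. *)
Definition node_gf (a : tree -> tree -> R) : fps R :=
  Fps (fun n => \sum_(k < n.+1) \sum_(l <- trees k) \sum_(r <- trees (n - k)) a l r).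

Lemma node_gfD a a' :
  node_gf (fun l r => a l r + a' l r) = node_gf a + node_gf a'.
Proof.
apply: fpsP => n /=; rewrite -big_split; apply: eq_bigr => k _ /=.
by rewrite -big_split; apply: eq_bigr => l _ /=; rewrite -big_split.
Qed.

Lemma node_gfM g g' : node_gf (fun l r => g l * g' r) = tree_gf g * tree_gf g'.
Proof.
apply: fpsP => n; rewrite coef_fpsM /=; apply: eq_bigr => k _.
by rewrite big_distrlr.
Qed.

Lemma tree_gf_node g :
  tree_gf g = fpsC (g Leaf) + fpsX R * node_gf (fun l r => g (Node l r)).
Proof.
apply: fpsP => n; rewrite -[RHS]/(fpsC (g Leaf) n + (fpsX R * node_gf _) n) coef_fpsXM /=.
case: n => [|n]; first by rewrite addr0 big_seq1.
rewrite add0r treesS big_flatten big_map -[iota 0 n.+1]/(index_iota 0 n.+1) big_mkord.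
apply: eq_bigr => k _.
by rewrite big_allpairs_dep.
Qed.

(** Solves the system met below, where [C] is the Catalan series, [A1] and [A2]
    record the degree of the root, [B] is for a second root at the root of a tree
    that hangs from an edge, [P] for a second root at any vertex other than the
    root, and [Q] records in addition the degree of the root. With [u = 1 - t C] and [w = 1 - x t C], one has [C u = 1] and
    [1 + y - 2 t x = 2 u w], which turns the solution
    [Q = t x1 x2 u / (y w1^2 w2^2)] into the stated form. Everything is
    multiplied out because the ring need not have inverses. *)
Lemma closed_form (t C x1 x2 A1 A2 B P Q y : R) :
    C = 1 + t * (C * C) -> y = 1 - 2 * t * C ->
    A1 = 1 + t * (C * (x1 * A1)) -> A2 = 1 + t * (C * (x2 * A2)) ->
    B = x2 + t * (C * (x2 * (B + x2 * A2))) ->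
    P = t * (B * C + P * C + C * P) ->
    Q = t * ((B + P) * (x1 * A1) + C * (x1 * Q)) ->
  Q * (2 * y * (1 + y - 2 * t * x1) ^+ 2 * (1 + y - 2 * t * x2) ^+ 2)
    = t * x1 * x2 * (y + 1) ^+ 5.
Proof.
move=> hC -> hA1 hA2 hB hP hQ.
set u := 1 - t * C; set w1 := 1 - x1 * t * C; set w2 := 1 - x2 * t * C.
have Cu : C * u = 1 by rewrite /u mulrBr {1}hC; ring.
have Aw1 : A1 * w1 = 1 by rewrite /w1 mulrBr {1}hA1; ring.
have Aw2 : A2 * w2 = 1 by rewrite /w2 mulrBr {1}hA2; ring.
have fac1 : 1 + (1 - 2 * t * C) - 2 * t * x1 = 2 * (u * w1).
  by rewrite -[2 * t * x1]mulr1 -Cu /w1 /u; ring.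
have fac2 : 1 + (1 - 2 * t * C) - 2 * t * x2 = 2 * (u * w2).
  by rewrite -[2 * t * x2]mulr1 -Cu /w2 /u; ring.
have Bw : B * w2 * w2 = x2.
  have -> : B * w2 = x2 + t * C * x2 * x2 * A2 by rewrite /w2 mulrBr {1}hB; ring.
  by rewrite mulrDl -[_ * A2 * w2]mulrA Aw2 /w2; ring.
have Py : (B + P) * (1 - 2 * t * C) = B * u.
  have -> : (B + P) * (1 - 2 * t * C) = B * u + (P - t * (B * C + P * C + C * P)).
    by rewrite /u; ring.
  by rewrite -hP subrr addr0.
have Qw : Q * w1 * w1 = t * x1 * (B + P).
  have -> : Q * w1 = t * (B + P) * x1 * A1 by rewrite /w1 mulrBr {1}hQ; ring.
  by rewrite -[_ * A1 * w1]mulrA Aw1; ring.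
rewrite fac1 fac2.
transitivity (32 * (u ^+ 4 * ((Q * w1 * w1) * (1 - 2 * t * C) * (w2 * w2)))); first by ring.
rewrite Qw -[t * x1 * _ * _]mulrA Py.
transitivity (32 * (u ^+ 4 * (t * x1 * (B * w2 * w2) * u))); first by ring.
by rewrite Bw /u; ring.
Qed.

End GeneratingFunctions.

Section Specialization.
Variable R : comNzRingType.
Variables x1 x2 : R.

Definition root_weight (x : R) T : R := x ^+ size (root_corners T).

(** The weight of the root of [T] once [T] hangs from an edge: its degree goes up
    by one, and any of its half-edges may be the second root. *)
Definition closed_root_weight (x : R) T : R :=
  x ^+ (size (root_corners T)).+1 *+ (size (root_corners T)).+1.

(** A vertex of degree [d] contributes [d] choices of the second root. *)
Definition others_weight T : R := \sum_(c <- other_vertices T) x2 ^+ size c *+ size c.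

Definition two_rooted_weight T : R := root_weight x1 T * others_weight T.

Lemma root_weight_node x l r : root_weight x (Node l r) = x * root_weight x r.
Proof. by rewrite /root_weight /= size_map exprS. Qed.

Lemma closed_root_weight_node x l r : closed_root_weight x (Node l r) =
  x * (closed_root_weight x r + x * root_weight x r).
Proof.
by rewrite /closed_root_weight /root_weight /= size_map mulrSr mulrDr mulrnAr -!exprS.
Qed.

Lemma others_weight_node l r : others_weight (Node l r) =
  closed_root_weight x2 l + others_weight l + others_weight r.
Proof.
rewrite /others_weight /= big_cons big_cat !big_map /= addrA.
rewrite /root_chain size_map size_rcons; congr (_ + _ + _).
  by apply: eq_bigr => c _; rewrite size_map.
by apply: eq_bigr => c _; rewrite size_map.
Qed.

Local Notation C := (tree_gf (fun=> 1 : R)).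

Lemma root_gf x : tree_gf (root_weight x) =
  1 + fpsX R * (C * (fpsC x * tree_gf (root_weight x))).
Proof.
rewrite {1}tree_gf_node -tree_gfZ -node_gfM; congr (_ + _ * _).
by congr node_gf; apply/funext => l; apply/funext => r; rewrite mul1r root_weight_node.
Qed.

Lemma catalan_gf : C = 1 + fpsX R * (C * C).
Proof.
rewrite {1}tree_gf_node -node_gfM; congr (_ + _ * _).
by congr node_gf; apply/funext => l; apply/funext => r; rewrite mulr1.
Qed.

Lemma closed_root_gf x : tree_gf (closed_root_weight x) = fpsC x + fpsX R *
  (C * (fpsC x * (tree_gf (closed_root_weight x) + fpsC x * tree_gf (root_weight x)))).
Proof.
rewrite {1}tree_gf_node -tree_gfZ -tree_gfD -tree_gfZ -node_gfM; congr (fpsC _ + _ * _).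
congr node_gf; apply/funext => l; apply/funext => r.
by rewrite mul1r closed_root_weight_node.
Qed.

Lemma fpsC0 : fpsC 0 = 0 :> fps R.
Proof. by apply: fpsP => -[]. Qed.

Lemma others_gf : tree_gf others_weight = fpsX R *
  (tree_gf (closed_root_weight x2) * C + tree_gf others_weight * C
    + C * tree_gf others_weight).
Proof.
rewrite {1}tree_gf_node -!node_gfM -!node_gfD.
have -> : others_weight Leaf = 0 by rewrite /others_weight big_nil.
rewrite fpsC0 add0r.
congr (_ * node_gf _); apply/funext => l; apply/funext => r.
by rewrite mul1r !mulr1 -others_weight_node.
Qed.

Lemma two_rooted_gf : tree_gf two_rooted_weight = fpsX R *
  ((tree_gf (closed_root_weight x2) + tree_gf others_weight)
      * (fpsC x1 * tree_gf (root_weight x1))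
    + C * (fpsC x1 * tree_gf two_rooted_weight)).
Proof.
rewrite {1}tree_gf_node -!tree_gfZ -!tree_gfD -!node_gfM -!node_gfD.
have -> : two_rooted_weight Leaf = 0.
  by rewrite /two_rooted_weight /others_weight big_nil mulr0.
rewrite fpsC0 add0r.
congr (_ * node_gf _); apply/funext => l; apply/funext => r.
rewrite /two_rooted_weight root_weight_node others_weight_node; ring.
Qed.

End Specialization.

(** Turns the coefficients of [G2], which count marked trees by their two degrees,
    into one sum over the marked trees. *)
Lemma sum_count_statistics (V : nmodType) (I : eqType) (L : seq I) (P : pred I)
    (D1 D2 : I -> nat) n (F : nat -> nat -> V) :
    {in L, forall i, (D1 i < n)%N} -> {in L, forall i, (D2 i < n)%N} ->
  \sum_(a < n) \sum_(b < n) F a b *+ count (fun i => [&& P i, D1 i == a & D2 i == b]) L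
    = \sum_(i <- L | P i) F (D1 i) (D2 i).
Proof.
elim: L => [|i L IH] lt1 lt2.
  by rewrite big_nil big1 // => a _; rewrite big1 // => b _; rewrite mulr0n.
rewrite big_cons -IH => [|k kL|k kL]; 
  try by [apply: lt1; rewrite inE kL orbT | apply: lt2; rewrite inE kL orbT].
have lt1i := lt1 i (mem_head _ _); have lt2i := lt2 i (mem_head _ _).
under eq_bigr => a _ do under eq_bigr => b _ do rewrite /= mulrnDr.
under eq_bigr => a _ do rewrite big_split.
rewrite big_split /=; case: (P i) => /=; last first.
  by rewrite big1 ?add0r // => a _; rewrite big1.
congr (_ + _); rewrite (bigD1 (Ordinal lt1i)) //= eqxx [X in _ + X]big1 ?addr0; last first.
  move=> a; rewrite -val_eqE /= eq_sym => /negbTE ne_a.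
  by rewrite ne_a big1.
rewrite (bigD1 (Ordinal lt2i)) //= eqxx [X in _ + X]big1 ?addr0 //.
by move=> b; rewrite -val_eqE /= eq_sym => /negbTE ->.
Qed.

Lemma sum_corners (R : comNzRingType) (x : R) e T : edges T = e ->
  \sum_(j <- enum 'I_(2 * e) | val j \notin root_corners T)
     x ^+ #|porbit (tree_sigma e T) j| = others_weight x T.
Proof.
move=> eT; rewrite -(perm_big _ (perm_ord_vertices eT)) big_flatten big_map.
rewrite {1}/vertices big_cons big_seq_cond big1 /= ?add0r; last first.
  by move=> j; rewrite mem_ord_corners => /andP[->].
rewrite /others_weight big_seq [RHS]big_seq; apply: eq_bigr => c c_other.
have cT : c \in vertices T by rewrite inE c_other orbT.
have dis i : i \in c -> i \notin root_corners T.
  move=> ic; have := perm_uniq (perm_vertices T); rewrite iota_uniq /= cat_uniq.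
  by case/and3P=> _ /hasPn/(_ i) + _; apply; apply/flattenP; exists c.
rewrite big_seq_cond (eq_bigl (fun j => j \in ord_corners e c)); last first.
  by move=> j; rewrite mem_ord_corners andb_idr //; apply: dis.
rewrite (eq_bigr (fun=> x ^+ size c)); last first.
  by move=> j; rewrite mem_ord_corners => jc; rewrite (card_tree_porbit eT cT jc).
rewrite -big_seq big_const_seq count_predT iter_addr addr0.
by have := congr1 size (ord_vertices_val eT cT); rewrite size_map => ->.
Qed.

Lemma size_root_corners T : (size (root_corners T) <= 2 * edges T)%N.
Proof.
have := perm_size (perm_vertices T); rewrite size_iota /= size_cat => <-.
exact: leq_addr.
Qed.

Lemma G2_tree_gf : G2 = tree_gf (two_rooted_weight 'X_ord0 'X_ord_max).
Proof.
apply: fpsP => e /=.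
under eq_bigr => d1 _ do under eq_bigr => d2 _ do rewrite scaler_nat T2_count.
rewrite (sum_count_statistics (I := (tree * 'I_(2 * e))%type)
  (D1 := fun Tj => size (root_corners Tj.1))
  (D2 := fun Tj => #|porbit (tree_sigma e Tj.1) Tj.2|)
  (fun Tj => val Tj.2 \notin root_corners Tj.1)
  (fun d1 d2 => 'X_ord0 ^+ d1 * 'X_ord_max ^+ d2)); first last.
- move=> [T j] _ /=; rewrite ltnS; apply: leq_trans (max_card _) _.
  by rewrite card_ord.
- move=> [T j] /allpairsP[[T1 j1] /= [+ _ [-> _]]]; rewrite mem_trees => /eqP <-.
  by rewrite ltnS size_root_corners.
rewrite big_mkcond big_allpairs big_seq [RHS]big_seq; apply: eq_bigr => T.
rewrite mem_trees => /eqP eT; rewrite -big_mkcond /= /two_rooted_weight.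
by rewrite -(sum_corners _ eT) mulr_sumr.
Qed.

Theorem mainTheorem7 (y : fps {mpoly rat[2]})
    (hy0 : y 0%N = 1) (hy : y ^+ 2 = 1 - 4 * fpsX {mpoly rat[2]}) :
  let t : fps {mpoly rat[2]} := fpsX {mpoly rat[2]} in
  let x1 : fps {mpoly rat[2]} := fpsC 'X_ord0 in
  let x2 : fps {mpoly rat[2]} := fpsC 'X_ord_max in
  G2 = (t * x1 * x2 * (y + 1) ^+ 5)
       / (2 * y * (1 + y - 2 * t * x1) ^+ 2 * (1 + y - 2 * t * x2) ^+ 2).
Proof.
move=> t x1 x2; have U := denominator_unit 'X_ord0 'X_ord_max hy0.
rewrite -[LHS](mulrK U); congr (_ / _); rewrite G2_tree_gf.
pose C : fps {mpoly rat[2]} := tree_gf (fun=> 1).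
have hC : C = 1 + t * (C * C) := catalan_gf _.
apply: (closed_form hC _ (root_gf _) (root_gf _) (closed_root_gf _) (others_gf _)
  (two_rooted_gf _ _)).
apply: fps_sqrt_uniq mpoly2_unit hy0 _ _.
  rewrite -[LHS]/(1 - (2 * t * C) 0%N) -mulrA mulrCA coef_fpsXM subr0 //.
rewrite hy -/t; have -> : (1 - 2 * t * C) ^+ 2 = 1 - 4 * t * (C - t * (C * C)) by ring.
by rewrite {1}hC addrK mulr1.
Qed.
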